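(* Let $M$ be an infinite strongly sofic monoid and let $\Sigma = (D_i,\sigma_i)_{i\in I}$ be a strong sofic approximation of $M$. Let $A$ be a finite set and let $X \subset A^M$ be a subshift. Then $h_\Sigma(X,M) \le \log|A|$. Moreover, $h_\Sigma(X,M) = \log|A|$ if and only if $X = A^M$.
   Context: $A^M$ is the set of maps $M\to A$ with the prodiscrete topology and the shift action $(mx)(m') = x(m'm)$; a subshift is a closed $M$-invariant subset. Hamming metric on $\operatorname{Map}(D)$ (all maps $D\to D$, $D$ finite non-empty): $d_D^{\mathrm{Ham}}(f,g) = \frac{1}{|D|}|\{v : f(v)\neq g(v)\}|$. A strong sofic approximation of $M$ is a net $(D_i,\sigma_i)_{i\in I}$ over a directed set, $D_i$ non-empty finite, $\sigma_i\colon M\to\operatorname{Map}(D_i)$, with $\sigma_i(1_M)=\mathrm{Id}_{D_i}$; $\lim_i d^{\mathrm{Ham}}_{D_i}(\sigma_i(m_1m_2),\sigma_i(m_1)\sigma_i(m_2))=0$ for all $m_1,m_2$; $\lim_i d^{\mathrm{Ham}}_{D_i}(\sigma_i(m_1),\sigma_i(m_2))=1$ for distinct $m_1,m_2$; and for every finite $K\subset M$ an integer $\Delta_K\ge1$ with $|\sigma_i(k)^{-1}(v)|\le\Delta_K$ for all $i$, $k\in K$, $v\in D_i$. A monoid is strongly sofic iff it admits one. A pseudometric $\rho$ on an $M$-space $X$ is dynamically generating if for distinct $x,y$ some $m$ has $\rho(mx,my)>0$. Sofic entropy: for $X$ compact with continuous $M$-action and continuous pseudometric $\rho$, for finite non-empty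 $D$ set $\rho_2^D(\varphi,\psi) = (\frac{1}{|D|}\sum_{v}\rho(\varphi(v),\psi(v))^2)^{1/2}$, $\rho_\infty^D(\varphi,\psi)=\max_v\rho(\varphi(v),\psi(v))$ on $X^D$, with $(m\varphi)(v)=m\varphi(v)$; for finite $F\subset M$, $\delta>0$, $\sigma\colon M\to\operatorname{Map}(D)$, $\operatorname{Map}(X,M,\rho,F,\delta,\sigma)=\{\varphi\in X^D:\rho_2^D(\varphi\circ\sigma(m),m\varphi)\le\delta\ \forall m\in F\}$; $N_\varepsilon(Z,d)$ is the maximal cardinality of a subset of $Z$ with pairwise $d$-distances $\ge\varepsilon$; $h_\Sigma(X,M,\rho)=\sup_{\varepsilon>0}\inf_F\inf_{\delta>0}\limsup_i\frac{1}{|D_i|}\log N_\varepsilon(\operatorname{Map}(X,M,\rho,F,\delta,\sigma_i),\rho_\infty^{D_i})$ ($\log 0=-\infty$). For $M$ infinite strongly sofic and $\Sigma$ a strong sofic approximation, this value is the same for all dynamically generating continuous pseudometrics $\rho$, and $h_\Sigma(X,M)$ denotes it (for subshifts one may take $\rho(x,y)=0$ if $x(1_M)=y(1_M)$ and $1$ otherwise). *)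

(* Defs.v *)
From HB Require Import structures.
From mathcomp Require Import all_boot all_order all_algebra.
From mathcomp Require Import all_classical all_reals.
From mathcomp Require Import ereal exp.
From Stdlib Require List.
Set Implicit Arguments. Unset Strict Implicit. Unset Printing Implicit Defensive.
Import Order.TTheory GRing.Theory Num.Theory.
Local Open Scope ring_scope.

Definition is_monoid (M : Type) (mul : M -> M -> M) (one : M) : Prop :=
  [/\ forall a b c, mul a (mul b c) = mul (mul a b) c,
      forall a, mul one a = a & forall a, mul a one = a].

Definition shift (M A : Type) (mul : M -> M -> M) (m : M) (x : M -> A) : M -> A :=
  fun m' => x (mul m' m).

(* closedness of X in the prodiscrete (product of discrete) topology on A^M:
   x belongs to X as soon as every basic open neighbourhood of x
   (given by a finite set K of coordinates) meets X *)
Definition prodiscrete_closed (M A : Type) (X : set (M -> A)) : Prop :=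
  forall x : M -> A,
    (forall K : seq M, exists y, X y /\ forall k, List.In k K -> y k = x k) -> X x.

Definition shift_invariant (M A : Type) (mul : M -> M -> M) (X : set (M -> A)) : Prop :=
  forall m x, X x -> X (shift mul m x).

Definition subshift (M A : Type) (mul : M -> M -> M) (X : set (M -> A)) : Prop :=
  prodiscrete_closed X /\ shift_invariant mul X.

Definition directed (I : Type) (le : I -> I -> Prop) : Prop :=
  [/\ inhabited I, forall i, le i i,
      forall i j k, le i j -> le j k -> le i k &
      forall i j, exists k, le i k /\ le j k].

Definition net_lim (R : realType) (I : Type) (le : I -> I -> Prop) (a : I -> R) (L : R) : Prop :=
  forall e : R, 0 < e -> exists i0, forall i, le i0 i -> `|a i - L| < e.

Definition net_limsup (R : realType) (I : Type) (le : I -> I -> Prop) (a : I -> \bar R) : \bar R :=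
  ereal_inf [set ereal_sup [set a i | i in [set i | le i0 i]] | i0 in [set: I]].

Definition hamming (R : realType) (D : finType) (f g : D -> D) : R :=
  #|[set v | f v != g v]|%:R / #|D|%:R.

Definition strong_sofic_approx (R : realType) (M : Type) (mul : M -> M -> M) (one : M)
  (I : Type) (le : I -> I -> Prop) (D : I -> finType) (sigma : forall i, M -> D i -> D i) : Prop :=
  directed le /\
  [/\ forall i, (0 < #|D i|)%N,
      forall i, sigma i one = id,
      forall m1 m2, net_lim le (fun i => hamming R (sigma i (mul m1 m2)) (sigma i m1 \o sigma i m2)) 0,
      forall m1 m2, m1 <> m2 -> net_lim le (fun i => hamming R (sigma i m1) (sigma i m2)) 1 &
      forall K : seq M, exists Delta : nat, (1 <= Delta)%N /\
        forall i k (v : D i), List.In k K -> (#|[set w | sigma i k w == v]| <= Delta)%N].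

Definition strongly_sofic (M : Type) (mul : M -> M -> M) (one : M) : Prop :=
  exists (R : realType) (I : Type) (le : I -> I -> Prop) (D : I -> finType)
         (sigma : forall i, M -> D i -> D i), strong_sofic_approx R mul one le sigma.

Definition elog (R : realType) (x : \bar R) : \bar R :=
  match x with
  | r%:E => if (r <= 0)%R then -oo else (ln r)%:E
  | +oo => +oo
  | -oo => -oo
  end%E.

Section SoficEntropy.
Variables (R : realType) (M : Type) (mul : M -> M -> M) (one : M) (A : finType).

(* the (dynamically generating, continuous) pseudometric on A^M:
   rho x y = 0 if x(1_M) = y(1_M), 1 otherwise *)
Definition rho_sub (x y : M -> A) : R := if x one == y one then 0 else 1.

Definition rho2 (D : finType) (phi psi : D -> M -> A) : R :=
  Num.sqrt (#|D|%:R^-1 * \sum_(v : D) rho_sub (phi v) (psi v) ^+ 2).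

Definition rhoinf (D : finType) (phi psi : D -> M -> A) : R :=
  \big[Num.max/0]_(v : D) rho_sub (phi v) (psi v).

Definition Map_set (X : set (M -> A)) (F : seq M) (delta : R) (D : finType)
  (s : M -> D -> D) : set (D -> M -> A) :=
  [set phi | (forall v, X (phi v)) /\
     forall m, List.In m F -> rho2 (phi \o s m) (fun v => shift mul m (phi v)) <= delta].

Definition N_sep (T : Type) (Z : set T) (d : T -> T -> R) (eps : R) : \bar R :=
  ereal_sup [set (n%:R)%:E | n in [set n : nat | exists f : 'I_n -> T,
      (forall j, Z (f j)) /\ forall j k, j != k -> eps <= d (f j) (f k)]].

Definition sofic_entropy (I : Type) (le : I -> I -> Prop) (D : I -> finType)
  (sigma : forall i, M -> D i -> D i) (X : set (M -> A)) : \bar R :=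
  ereal_sup [set
    ereal_inf [set
      ereal_inf [set
        net_limsup le (fun i =>
          ((#|D i|%:R^-1)%:E * elog (N_sep (Map_set X F delta (sigma i)) (@rhoinf (D i)) eps))%E)
      | delta in [set delta : R | 0 < delta]]
    | F in [set: seq M]]
  | eps in [set eps : R | 0 < eps]].
End SoficEntropy.

(* Main.v *)
(** A microstate [phi] is determined, up to [rhoinf]-distance [0], by its labelling
    [v |-> phi v 1], so there are at most [#|A| ^ #|D|] of them; on the full shift
    every labelling is realised.  If [X] misses a pattern [p] on a finite set [K],
    the labelling of a microstate shows [p] around only few [v].  The bound on the
    fibers of [sigma k] yields greedily a set [V] of size proportional to [#|D|]
    whose neighborhoods [sigma K v] are pairwise disjoint, and giving each labelling
    the weight [2^-n], with [n] the number of [v] in [V] around which [p] occurs,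
    makes the total weight factor over [V] (a Chernoff bound): the labellings
    showing [p] rarely are exponentially fewer than [#|A| ^ #|D|]. *)
Require Import Defs.
From HB Require Import structures.
From mathcomp Require Import all_boot all_order all_algebra.
From mathcomp Require Import all_classical all_reals.
From mathcomp Require Import ereal sequences exp.
From mathcomp Require Import ring lra.
Set Implicit Arguments. Unset Strict Implicit. Unset Printing Implicit Defensive.
Import Order.TTheory GRing.Theory Num.Theory.
Local Open Scope ring_scope.
Local Open Scope classical_set_scope.

Lemma card_bigcup_le (T D : finType) (Q : pred T) (F : T -> {set D}) :
  (#|\bigcup_(t | Q t) F t|%SET <= \sum_(t | Q t) #|F t|)%N.
Proof.
elim/big_ind2: _ => [|n1 S1 n2 S2 h1 h2|//]; first by rewrite cards0.
by apply: leq_trans (leq_card_setU _ _) (leq_add h1 h2).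
Qed.

(** * Counting the labellings of a finite set that show a pattern rarely *)

Section Patterns.
Variables (D A : finType) (k : nat) (s : 'I_k -> D -> D) (p : 'I_k -> A).
Implicit Types (u : {ffun D -> A}) (v w d : D).

Definition occurs u v : bool := [forall j, u (s j v) == p j].

(** The points [s j v] may coincide for different [j]; this is the condition under which [p] can be
    placed around [v] at all. *)
Definition consistent v : Prop := forall j l, s j v = s l v -> p j = p l.

Definition conflict v w : bool := [exists j, exists l, s j v == s l w].

Definition overwrite v u : {ffun D -> A} :=
  [ffun d => if [pick j | s j v == d] is Some j then p j else u d].

Lemma conflict_sym v w : conflict v w -> conflict w v.
Proof.
by move=> /existsP[j /existsP[l e]]; apply/existsP; exists l; apply/existsP; exists j; rewrite eq_sym.
Qed.

Lemma occurs_overwrite v u : consistent v -> occurs (overwrite v u) v.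
Proof.
move=> cv; apply/forallP => j; rewrite ffunE; case: pickP => [l /eqP/cv-> //|].
by move=> /(_ j); rewrite eqxx.
Qed.

Lemma overwrite_id v u d : (forall j, s j v != d) -> overwrite v u d = u d.
Proof. by move=> h; rewrite ffunE; case: pickP => // j; rewrite (negbTE (h j)). Qed.

Lemma occurs_overwrite_away v w u :
  ~~ conflict v w -> occurs (overwrite v u) w = occurs u w.
Proof.
move=> nc; apply: eq_forallb => l; rewrite overwrite_id // => j.
by apply: contraNneq nc => e; apply/existsP; exists j; apply/existsP; exists l; apply/eqP.
Qed.

(** A labelling in the fiber agrees with [w0] away from the points [s j v], so its [k] values at
    these points determine it. *)
Lemma card_overwrite_fiber v (w0 : {ffun D -> A}) :
  (#|[set u | overwrite v u == w0]%SET| <= #|A| ^ k)%N.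
Proof.
pose h u : {ffun 'I_k -> A} := [ffun j => u (s j v)].
have -> : (#|A| ^ k = #|{ffun 'I_k -> A}|)%N by rewrite card_ffun card_ord.
apply: (@leq_card_in _ _ h) => u u'; rewrite !inE => /eqP e /eqP e' /ffunP hh.
apply/ffunP => d; case: (pickP (fun j => s j v == d)) => [j /eqP<-|n].
  by have := hh j; rewrite !ffunE.
have nd j : s j v != d by rewrite n.
by rewrite -(overwrite_id u nd) -(overwrite_id u' nd) e e'.
Qed.

(* The map [overwrite v] has fibers of size at most [#|A| ^ k] and preserves
   functions that do not depend on the values near [v]. *)
Lemma sum_le_sum_occurs (R : realType) v (f : {ffun D -> A} -> R) :
  consistent v -> (forall u, 0 <= f u) -> (forall u, f (overwrite v u) = f u) ->
  \sum_u f u <= #|A|%:R ^+ k * \sum_(u | occurs u v) f u.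
Proof.
move=> cv f0 fE.
rewrite (partition_big (overwrite v) (fun u => occurs u v)) /=; last first.
  by move=> u _; exact: occurs_overwrite.
rewrite mulr_sumr; apply: ler_sum => w0 _.
rewrite (eq_bigr (fun=> f w0)); last by move=> u /eqP <-; rewrite fE.
rewrite sumr_const -[leLHS]mulr_natl ler_wpM2r // -natrX ler_nat.
by have := card_overwrite_fiber v w0; rewrite cardsE.
Qed.

(** The Chernoff weight; [V] is a sequence so that points can be added one at a time by
    induction. *)
Definition weight (R : realType) (V : seq D) u : R :=
  \prod_(v <- V) (if occurs u v then 2^-1 else 1).

Definition decay (R : realType) : R := 1 - (2 * #|A|%:R ^+ k)^-1.

Lemma weight_ge0 (R : realType) V u : 0 <= weight R V u.
Proof. by apply: prodr_ge0 => v _; case: ifP => _; rewrite ?invr_ge0. Qed.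

Lemma decay_bounds (R : realType) : (0 < #|A|)%N -> 0 < decay R < 1.
Proof.
move=> A0; have h : (1 : R) <= #|A|%:R ^+ k by rewrite -natrX ler1n expn_gt0 A0.
have h2 : (2 * #|A|%:R ^+ k : R)^-1 <= 2^-1 by rewrite lef_pV2 ?posrE; lra.
have h3 : 0 < (2 * #|A|%:R ^+ k : R)^-1 by rewrite invr_gt0; lra.
by rewrite /decay; apply/andP; split; lra.
Qed.

(** Adding [v] to [V] halves the terms with [p] around [v]. The other factors do not see an
    overwriting near [v], so these terms carry at least a fraction [#|A| ^- k] of the sum; halving
    them costs a factor [decay]. *)
Lemma sum_weight_le (R : realType) (V : seq D) :
  (0 < #|A|)%N -> uniq V -> (forall v, v \in V -> consistent v) ->
  {in V &, forall v w, v != w -> ~~ conflict v w} ->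
  \sum_u weight R V u <= #|A|%:R ^+ #|D| * decay R ^+ size V.
Proof.
move=> A0; elim: V => [_ _ _|v V IH] /=.
  rewrite /weight (eq_bigr (fun=> 1)) => [|u _]; last by rewrite big_nil.
  by rewrite sumr_const card_ffun natrX expr0 mulr1.
move=> /andP[vV uV] cV iV.
have {}IH := IH uV (fun w h => cV w (mem_behead (s := v :: V) h))
  (fun a b ha hb => iV a b (mem_behead (s := v :: V) ha) (mem_behead (s := v :: V) hb)).
have/andP[q0 _] := decay_bounds R A0.
have cv : consistent v by apply: cV; rewrite mem_head.
have wE u : weight R V (overwrite v u) = weight R V u.
  apply: eq_big_seq => w wV; rewrite occurs_overwrite_away //; apply: iV.
  - exact: mem_head.
  - by rewrite inE wV orbT.
  - by apply: contraNneq vV => ->.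
have hs := sum_le_sum_occurs cv (@weight_ge0 R V) wE.
have -> : \sum_u weight R (v :: V) u =
    \sum_u weight R V u - 2^-1 * \sum_(u | occurs u v) weight R V u.
  rewrite mulr_sumr [X in _ - X]big_mkcond -sumrB; apply: eq_bigr => u _.
  by rewrite {1}/weight big_cons -/(weight R V u); case: ifP => _; lra.
apply: (@le_trans _ _ (decay R * \sum_u weight R V u)); last first.
  by rewrite exprS mulrCA ler_wpM2l // ltW.
have a0 : 0 < #|A|%:R ^+ k :> R by rewrite exprn_gt0 // ltr0n.
rewrite /decay mulrBl mul1r lerD2l lerN2 invfM -mulrA ler_wpM2l ?invr_ge0 //.
by rewrite ler_pdivrMl.
Qed.

Lemma weightE (R : realType) (V : {set D}) u :
  weight R (enum V) u = 2^-1 ^+ #|[set v in V | occurs u v]%SET|.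
Proof.
rewrite /weight big_enum /= -big_mkcondr /= -prodr_const.
by apply: eq_bigl => v; rewrite inE.
Qed.

(** Take [V] maximal among the conflict-free subsets of [G]. Every point of [G] then lies in [V] or
    conflicts with a point of [V], and a given [v] conflicts with at most [k * k * b] points:
    [k * k] pairs of indices, each with a fiber of size at most [b]. *)
Lemma exists_independent (G : {set D}) (b : nat) :
  (forall v j l, (#|[set w | s l w == s j v]%SET| <= b)%N) ->
  exists2 V : {set D}, (V \subset G)%SET & {in V &, forall v w, v != w -> ~~ conflict v w} /\
    (#|G| <= #|V| * (k * k * b).+1)%N.
Proof.
move=> hb.
pose P (V : {set D}) := (V \subset G)%SET &&
  [forall v in V, forall w in V, (v != w) ==> ~~ conflict v w].
have [|V /maxsetP[/andP[VG /forall_inP iV] Vmax]] := @ex_maxset _ P.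
  by exists finset.set0; rewrite /P finset.sub0set; apply/forall_inP => v; rewrite inE.
have {}iV : {in V &, forall v w, v != w -> ~~ conflict v w}.
  by move=> v w hv hw; have /forall_inP/(_ w hw)/implyP := iV v hv.
exists V => //; split => //.
pose N v : {set D} := (v |: \bigcup_(x : 'I_k * 'I_k) [set w | s x.2 w == s x.1 v])%SET.
have GN : (G \subset \bigcup_(v in V) N v)%SET.
  apply/fintype.subsetP => w wG; case: (boolP (w \in V)) => wV.
    by apply/finset.bigcupP; exists w => //; rewrite !inE eqxx.
  case: (boolP [exists v in V, conflict v w]) => [/exists_inP[v vV]|/exists_inPn nc].
    move=> /existsP[j /existsP[l /eqP e]]; apply/finset.bigcupP; exists v => //.
    by rewrite !inE; apply/orP; right; apply/finset.bigcupP; exists (j, l) => //; rewrite inE /= e.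
  (* A point of [G] outside [V] and in conflict with nothing in [V] could be added, against
     maximality. *)
  have PwV : P (w |: V)%SET.
    rewrite /P finset.subUset finset.sub1set wG VG /=.
    apply/forall_inP => a; rewrite !inE => aV; apply/forall_inP => c; rewrite !inE => cV.
    apply/implyP => ac; case/orP: aV => [/eqP ea|aV]; case/orP: cV => [/eqP ec|cV].
    - by rewrite ea ec eqxx in ac.
    - by rewrite ea; apply: contra (nc _ cV) => /conflict_sym.
    - by rewrite ec; exact: nc.
    - exact: iV.
  by have := Vmax _ PwV (finset.subsetUr _ _) => e; rewrite -e !inE eqxx in wV.
apply: leq_trans (subset_leq_card GN) _.
apply: leq_trans (card_bigcup_le _ _) _; rewrite -sum_nat_const; apply: leq_sum => v _.
rewrite /N; apply: leq_trans (leq_card_setU _ _) _; rewrite cards1 add1n ltnS.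
apply: leq_trans (card_bigcup_le _ _) _.
apply: (@leq_trans (\sum_(x : 'I_k * 'I_k) b)); first by apply: leq_sum => x _; exact: hb.
by rewrite sum_nat_const card_prod !card_ord.
Qed.

(** Markov's inequality: at most [t] occurrences overall means at most [t] in [V], hence weight at
    least [2^-t], which is [expR (- (ln 2 * t))]. *)
Lemma card_few_occurrences_le (R : realType) (V : {set D}) (t : R) :
  (0 < #|A|)%N -> {in V, forall v, consistent v} ->
  {in V &, forall v w, v != w -> ~~ conflict v w} ->
  #|[set u | #|[set v | occurs u v]%SET|%:R <= t]%SET|%:R <=
    expR (ln 2 * t) * (#|A|%:R ^+ #|D| * decay R ^+ #|V|).
Proof.
move=> A0 cV iV.
have hs : \sum_u weight R (enum V) u <= #|A|%:R ^+ #|D| * decay R ^+ #|V|.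
  rewrite cardE; apply: sum_weight_le => //; first exact: enum_uniq.
    by move=> v; rewrite mem_enum; exact: cV.
  by move=> v w; rewrite !mem_enum; exact: iV.
apply: le_trans (ler_wpM2l (expR_ge0 _) hs).
rewrite -sum1_card natr_sum mulr_sumr [leLHS]big_mkcond.
apply: ler_sum => u _; case: ifP => [|_]; last by rewrite mulr_ge0 ?expR_ge0 ?weight_ge0.
rewrite inE weightE => ht.
have -> : 2^-1 = expR (- ln 2) :> R by rewrite expRN lnK // posrE.
rewrite -expRM_natl -expRD -[leLHS]expR0 ler_expR.
have h1 : #|[set v in V | occurs u v]%SET|%:R <= t.
  apply: le_trans ht; rewrite ler_nat; apply/subset_leq_card/fintype.subsetP => v.
  by rewrite !inE => /andP[].
have h2 : 0 <= ln 2 :> R by rewrite ln_ge0 // ler1n.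
have -> : ln 2 * t + #|[set v in V | occurs u v]%SET|%:R * - ln 2 =
    ln 2 * (t - #|[set v in V | occurs u v]%SET|%:R) :> R by lra.
by rewrite mulr_ge0 // subr_ge0.
Qed.

End Patterns.

(** * Extended logarithm, lists as indexed families, and eventual properties along a net *)

Lemma elog_le (R : realType) (x y : \bar R) : (x <= y)%E -> (elog x <= elog y)%E.
Proof.
case: x y => [x| |] [y| |] //=; rewrite ?lee_fin ?leey ?leNye //.
move=> xy; case: ifPn => [_|]; first by rewrite leNye.
rewrite -ltNge => x0; have y0 := lt_le_trans x0 xy.
by rewrite (leNgt y) y0 /= lee_fin ler_ln.
Qed.

(** For [a = 0] both sides are [-oo], since [0 < d] makes the power vanish and keeps the factor
    positive. *)
Lemma elog_natX (R : realType) (a d : nat) : (0 < d)%N ->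
  ((d%:R^-1)%:E * elog ((a ^ d)%N%:R%:E : \bar R))%E = elog (a%:R%:E).
Proof.
move=> d0 /=; rewrite !lern0 expn_eq0 d0 andbT.
have d0' : 0 < d%:R :> R by rewrite ltr0n.
case: eqP => [_|/eqP a0]; first by rewrite gt0_muleNy // lte_fin invr_gt0.
rewrite -EFinM natrX lnXn ?ltr0n ?lt0n // -[ln _ *+ d]mulr_natl mulrA mulVf ?mul1r //.
by rewrite gt_eqF.
Qed.

Lemma In_nth (T : Type) (x0 : T) (K : seq T) x :
  List.In x K <-> exists j : 'I_(size K), nth x0 K j = x.
Proof.
elim: K => [|y K IH] /=; first by split=> // -[[]].
split=> [[->|/IH[j <-]]|[[[|j] hj] /= e]].
- by exists ord0.
- by exists (lift ord0 j).
- by left.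
- by right; apply/IH; exists (Ordinal (hj : (j < size K)%N)).
Qed.

Lemma directed_fin_eventually (I : Type) (le : I -> I -> Prop) (T : finType)
  (P : T -> I -> Prop) : directed le ->
  (forall t, exists i0, forall i, le i0 i -> P t i) ->
  exists i0, forall i, le i0 i -> forall t, P t i.
Proof.
move=> [[i0] _ tr up] hP.
suff [j hj] : exists j, forall i, le j i -> forall t, t \in enum T -> P t i.
  by exists j => i /hj h t; apply: h; rewrite mem_enum.
elim: (enum T) => [|t s [j hj]]; first by exists i0 => i _ t.
have [l hl] := hP t; have [m [jm lm]] := up j l.
exists m => i mi t'; rewrite inE => /orP[/eqP->|]; first exact/hl/(tr _ _ _ lm).
exact/hj/(tr _ _ _ jm).
Qed.

(** * Microstates and separated families for the pseudometric read at [one] *)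

Section Entropy.
Variables (R : realType) (M : Type) (mul : M -> M -> M) (one : M) (A : finType).
Implicit Types (X : set (M -> A)) (D : finType).

(** As [rho_sub] takes only the values 0 and 1, the square of [rho2] is the proportion of points
    with different labels. *)
Lemma rho2_disagreement D (phi psi : D -> M -> A) (delta : R) :
  (0 < #|D|)%N -> rho2 R one phi psi <= delta ->
  #|[set v | phi v one != psi v one]%SET|%:R <= delta ^+ 2 * #|D|%:R.
Proof.
move=> D0; rewrite /rho2; set S := \sum_(v : D) _.
have -> : S = #|[set v | phi v one != psi v one]%SET|%:R.
  rewrite /S -sum1_card natr_sum [RHS]big_mkcond; apply: eq_bigr => v _.
  by rewrite inE /rho_sub; case: eqP => _; rewrite ?expr0n ?expr1n.
have D0' : 0 < #|D|%:R :> R by rewrite ltr0n.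
move=> h; have := lerXn2r 2 _ _ h; rewrite !nnegrE => /(_ (sqrtr_ge0 _)).
move=> /(_ (le_trans (sqrtr_ge0 _) h)); rewrite sqr_sqrtr ?mulr_ge0 ?invr_ge0 ?ler0n //.
by rewrite ler_pdivrMl // mulrC.
Qed.

Lemma rhoinf_gt0P D (phi psi : D -> M -> A) (eps : R) : 0 < eps ->
  eps <= rhoinf R one phi psi -> exists v, phi v one != psi v one.
Proof.
move=> e0 he; apply/existsP; apply: contraTT he => /existsPn h.
rewrite -ltNge; apply: le_lt_trans e0; apply: bigmax_le => // v _.
by rewrite /rho_sub; have := h v; rewrite negbK => ->.
Qed.

Lemma rhoinf_ge1 D (phi psi : D -> M -> A) v :
  phi v one != psi v one -> 1 <= rhoinf R one phi psi.
Proof.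
move=> h; apply: le_trans (le_bigmax _ _ v).
by rewrite /rho_sub (negbTE h).
Qed.

(** Microstates at positive distance have different labellings, so a separated family injects into
    [W]. *)
Lemma N_sep_le_card D (Z : set (D -> M -> A)) (eps : R) (W : {set {ffun D -> A}}) :
  0 < eps -> (forall phi, Z phi -> [ffun v => phi v one] \in W) ->
  (N_sep Z (@rhoinf R M one A D) eps <= #|W|%:R%:E)%E.
Proof.
move=> e0 hW; apply: ge_ereal_sup => _ [n [f [fZ fsep]] <-].
rewrite lee_fin ler_nat -[n in (n <= _)%N]card_ord.
pose h j := [ffun v => f j v one].
have hinj : injective h.
  move=> j l /ffunP e; apply/eqP/negP => /negP /fsep /(rhoinf_gt0P e0)[v].
  by have := e v; rewrite !ffunE => ->; rewrite eqxx.
rewrite -(card_imset predT hinj); apply/subset_leq_card/fintype.subsetP => _ /imsetP[j _ ->].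
exact: hW.
Qed.

(** * Entropy bounds along a strong sofic approximation *)

Section Net.
Variables (I : Type) (le : I -> I -> Prop) (D : I -> finType).
Variables (sigma : forall i, M -> D i -> D i).
Arguments sigma : clear implicits.
Hypothesis HSigma : strong_sofic_approx R mul one le sigma.

Lemma sofic_entropy_le X (c : \bar R) :
  (forall eps : R, 0 < eps -> exists F (delta : R), 0 < delta /\ exists i0, forall i, le i0 i ->
    ((#|D i|%:R^-1)%:E *
      elog (N_sep (Map_set mul one X F delta (sigma i)) (@rhoinf R M one A (D i)) eps) <= c)%E) ->
  (sofic_entropy R mul one le sigma X <= c)%E.
Proof.
move=> h; apply: ge_ereal_sup => _ [eps /= e0 <-].
have [F [delta [d0 [i0 hi]]]] := h eps e0.
apply: ge_ereal_inf; exists (ereal_inf [set net_limsup le (fun i => (#|D i|%:R^-1)%:E *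
   elog (N_sep (Map_set mul one X F del (sigma i)) (@rhoinf R M one A (D i)) eps))%E |
   del in [set del : R | 0 < del]]); first by exists F.
apply: ge_ereal_inf; eexists; first by exists delta.
apply: ge_ereal_inf; eexists; first by exists i0.
by apply: ge_ereal_sup => _ [i /hi ? <-].
Qed.

Lemma sofic_entropy_le_elog_card X :
  (sofic_entropy R mul one le sigma X <= elog (#|A|%:R%:E))%E.
Proof.
have [[[i0] _ _ _] [D0 _ _ _ _]] := HSigma.
apply: sofic_entropy_le => eps e0; exists [::], 1; split => //; exists i0 => i _.
rewrite -(elog_natX R _ (D0 i)); apply: lee_wpmul2l; first by rewrite lee_fin invr_ge0.
apply: elog_le; rewrite -card_ffun -cardsT; exact: N_sep_le_card.
Qed.

(* Every labelling [y : D -> A] lifts to the microstate [v, m |-> y (sigma m v)],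
   which satisfies the equivariance condition exactly. *)
Lemma sofic_entropy_fullshift : is_monoid mul one ->
  (elog (#|A|%:R%:E) <= sofic_entropy R mul one le sigma [set: M -> A])%E.
Proof.
move=> [_ mul1 _]; have [[_ refl _ _] [D0 s1 _ _ _]] := HSigma.
(* Scale 1 already separates distinct labellings. Each tail of the net contains its first index,
   which bounds the limsup from below. *)
apply: le_ereal_sup_tmp; eexists; first by exists 1; [exact: ltr01|].
apply: le_ereal_inf_tmp => _ [F _ <-]; apply: le_ereal_inf_tmp => _ [delta d0 <-].
apply: le_ereal_inf_tmp => _ [i _ <-]; apply: le_ereal_sup_tmp.
eexists; first by exists i => //; exact: refl.
rewrite -(elog_natX R _ (D0 i)); apply: lee_wpmul2l; first by rewrite lee_fin invr_ge0.
apply/elog_le/ereal_sup_ubound; rewrite -card_ffun; exists #|{ffun D i -> A}| => //.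
pose y (j : 'I_#|{ffun D i -> A}|) : {ffun D i -> A} := enum_val j.
exists (fun j v m => y j (sigma i m v)); split.
  (* Only the values at [one] are compared, and there both sides are [y j (sigma i m v)]. *)
  move=> j; split => // m _; rewrite /rho2 big1 ?mulr0 ?sqrtr0 ?(ltW d0) // => v _.
  by rewrite /rho_sub /shift /= s1 mul1 eqxx expr0n.
move=> j l jl; have [v hv] : exists v, y j v != y l v.
  apply/existsP; apply: contraNT jl => /existsPn h; apply/eqP/enum_val_inj/ffunP => v.
  by apply/eqP; have := h v; rewrite negbK.
by apply: (@rhoinf_ge1 _ _ _ v); rewrite s1.
Qed.

(** For distinct elements of [K] the Hamming distance tends to 1, so their images coincide on a
    vanishing proportion of points; a union bound over pairs leaves half of [D i]. Since [K] may
    have repetitions, elements are compared instead of indices. *)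
Lemma eventually_injective (K : seq M) :
  exists i0, forall i, le i0 i ->
    #|D i|%:R / 2 <= #|[set v | [forall j : 'I_(size K), forall l : 'I_(size K),
      (sigma i (nth one K j) v == sigma i (nth one K l) v) ==>
      `[< nth one K j = nth one K l >]]]%SET|%:R :> R.
Proof.
have [dir [D0 _ _ sep _]] := HSigma.
(* The [k * k] pairs together spoil at most half of the points; the successor keeps [e] positive
   when [K] is empty. *)
pose k := size K; pose e : R := (2 * (k * k).+1%:R)^-1.
have e0 : 0 < e by rewrite invr_gt0 mulr_gt0.
pose N i (x : 'I_k * 'I_k) := [set v | (sigma i (nth one K x.1) v == sigma i (nth one K x.2) v) &&
  ~~ `[< nth one K x.1 = nth one K x.2 >]]%SET.
have [i0 hi0] : exists i0, forall i, le i0 i -> forall x, #|N i x|%:R <= e * #|D i|%:R.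
  apply: directed_fin_eventually => // x.
  case: (pselect (nth one K x.1 = nth one K x.2)) => [eqx|neqx].
    have [[i0] _ _ _] := dir; exists i0 => i _.
    have -> : N i x = finset.set0 by apply/setP => v; rewrite !inE asboolT // andbF.
    by rewrite cards0 mulr_ge0 // ltW.
  have [i0 hi0] := sep _ _ neqx e e0; exists i0 => i /hi0; rewrite /hamming.
  have d0 : 0 < #|D i|%:R :> R by rewrite ltr0n.
  set B := [set v | _]%SET => h.
  have -> : N i x = (~: B)%SET by apply/setP => v; rewrite !inE negbK asboolF // andbT.
  rewrite cardsCs finset.setCK natrB ?max_card // -ler_pdivrMr // mulrBl mulfV ?gt_eqF //.
  by rewrite -normrN opprB in h; apply: le_trans (ltW h); exact: ler_norm.
exists i0 => i /hi0 h; set G := [set v | _]%SET.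
have d0 : 0 < #|D i|%:R :> R by rewrite ltr0n.
have cG : (#|~: G| <= \sum_x #|N i x|)%N.
  apply: leq_trans (card_bigcup_le _ _); apply/subset_leq_card/fintype.subsetP => v.
  rewrite !inE negb_forall => /existsP[j]; rewrite negb_forall => /existsP[l].
  by rewrite negb_imply => hjl; apply/finset.bigcupP; exists (j, l); rewrite ?inE.
have : #|~: G|%:R <= #|D i|%:R / 2 :> R.
  apply: (@le_trans _ _ (\sum_x #|N i x|)%:R); first by rewrite ler_nat.
  rewrite natr_sum; apply: (@le_trans _ _ (\sum_(x : 'I_k * 'I_k) e * #|D i|%:R)).
    by apply: ler_sum => x _; exact: h.
  rewrite sumr_const card_prod !card_ord -[leLHS]mulr_natl /e invfM.
  rewrite [leRHS]mulrC -!mulrA mulrCA ler_wpM2l ?invr_ge0 // mulrA.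
  rewrite -[leRHS]mul1r ler_wpM2r ?ler0n //.
  by rewrite ler_pdivrMr ?ltr0n // mul1r ler_nat.
have -> : #|~: G|%:R = #|D i|%:R - #|G|%:R :> R.
  by rewrite cardsCs finset.setCK natrB ?max_card.
lra.
Qed.

(** If the labelling of a microstate [phi] shows the pattern around [v], then, as [phi v] does not,
    equivariance fails at [v] for some element of [K]. Each element fails at no more than
    [delta ^+ 2 * #|D i|] points, so the pattern is shown rarely and the count of such labellings
    applies. *)
Lemma N_sep_forbidden_le X (x : M -> A) (K : seq M) (Delta : nat) (delta eps : R) i :
  is_monoid mul one -> 0 < eps -> (0 < #|A|)%N ->
  (forall y, X y -> ~ (forall m, List.In m K -> y m = x m)) ->
  (forall m (v : D i), List.In m K -> (#|[set w | sigma i m w == v]%SET| <= Delta)%N) ->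
  let k := size K in
  #|D i|%:R / 2 <= #|[set v | [forall j : 'I_k, forall l : 'I_k,
      (sigma i (nth one K j) v == sigma i (nth one K l) v) ==>
      `[< nth one K j = nth one K l >]]]%SET|%:R :> R ->
  exists n, (N_sep (Map_set mul one X K delta (sigma i)) (@rhoinf R M one A (D i)) eps
     <= n%:R%:E)%E /\
    n%:R <= expR (ln 2 * (k%:R * delta ^+ 2 * #|D i|%:R)) *
      (#|A|%:R ^+ #|D i| * expR (#|D i|%:R / (2 * (k * k * Delta).+1%:R) * ln (decay A k R))).
Proof.
move=> [_ mul1 _] eps0 A0 forb hDelta k; set G := [set v | _]%SET => hG.
have [_ [D0 _ _ _ _]] := HSigma.
pose s (j : 'I_k) := sigma i (nth one K j); pose p (j : 'I_k) := x (nth one K j).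
have inK (j : 'I_k) : List.In (nth one K j) K by apply/(In_nth one); exists j.
have [|V VG [iV cardV]] := @exists_independent _ _ s G Delta.
  by move=> v j l; exact: hDelta.
have cV : {in V, forall v, consistent s p v}.
  move=> v /(fintype.subsetP VG); rewrite inE => /forallP hv j l e.
  by have /forallP/(_ l)/implyP/(_ (introT eqP e))/asboolP := hv j; rewrite /p => ->.
have hcount := card_few_occurrences_le (k%:R * delta ^+ 2 * #|D i|%:R : R) A0 cV iV.
have /andP[q0 q1] := decay_bounds k R A0.
eexists; split; last first.
  apply: le_trans hcount _; rewrite ler_wpM2l ?expR_ge0 // ler_wpM2l ?exprn_ge0 //.
  (* The independent set has size at least [#|D i| / (2 * (k * k * Delta).+1)], and
     [ln (decay A k R)] is negative, which reverses the inequality. *)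
  rewrite -[X in X ^+ _](@lnK R) ?posrE // -expRM_natl ler_expR ler_wnM2r ?ln_le0 ?(ltW q1) //.
  rewrite invfM mulrA ler_pdivrMr ?ltr0n //; apply: le_trans hG _.
  by rewrite -natrM ler_nat.
apply: N_sep_le_card => // phi [phiX phiF]; rewrite inE.
have sub : ([set v | occurs s p [ffun w => phi w one] v]%SET \subset
    \bigcup_(j : 'I_k) [set v | (phi \o s j) v one != shift mul (nth one K j) (phi v) one]%SET)%SET.
  apply/fintype.subsetP => v; rewrite inE => /forallP hv; apply: contrapT => /negP nb.
  apply: (forb (phi v)) => // m /(In_nth one)[j <-].
  have := hv j; rewrite ffunE => /eqP; rewrite -/(p j) => <-.
  apply/eqP/negPn; apply: contra nb => nb; apply/finset.bigcupP; exists j => //.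
  by rewrite inE /shift /= mul1 eq_sym.
have := leq_trans (subset_leq_card sub) (card_bigcup_le _ _); rewrite -(ler_nat R) => /le_trans; apply.
rewrite natr_sum -mulrA mulr_natl -[k in leRHS]card_ord -sumr_const; apply: ler_sum => j _.
exact: (@rho2_disagreement _ (phi \o s j) _ _ (D0 i) (phiF _ (inK j))).
Qed.

(** Closedness provides a forbidden pattern [x] on a finite [K]. The resulting gap [c] below
    [ln #|A|] is the same for every [eps], so it survives the supremum. *)
Lemma sofic_entropy_lt X : is_monoid mul one -> prodiscrete_closed X ->
  X <> [set: M -> A] -> (sofic_entropy R mul one le sigma X < elog (#|A|%:R%:E))%E.
Proof.
move=> Hmon Xcl Xn.
have [x [K forb]] : exists x K, forall y, X y -> ~ (forall m, List.In m K -> y m = x m).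
  apply: contrapT => h; apply: Xn; apply/seteqP; split=> // x _; apply: Xcl => K.
  apply: contrapT => hy; apply: h; exists x, K => y Xy yx; apply: hy; by exists y.
have A0 : (0 < #|A|)%N by apply/card_gt0P; exists (x one).
have a0 : 0 < #|A|%:R :> R by rewrite ltr0n.
have [[[? _ _ _]] [D0 _ _ _ fib]] := HSigma.
have [Delta [_ hDelta]] := fib K; have [i0 hi0] := eventually_injective K.
set k := size K; set q := decay A k R; set b : R := 2 * (k * k * Delta).+1%:R.
have /andP[q0 q1] := decay_bounds k R A0; rewrite -/q in q0 q1.
have lnq : ln q < 0 by rewrite ln_lt0 // q0.
have b0 : 0 < b by rewrite mulr_gt0 // ltr0n.
have ln2 : 0 < ln 2 :> R by rewrite ln_gt0 // ltr1n.
(* Per point, the independent set gains [ln q / b], that is [- 2 * c]; half of this is left to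
   absorb the equivariance errors. *)
pose c := - ln q / (2 * b).
have c0 : 0 < c by rewrite divr_gt0 ?oppr_gt0 // mulr_gt0.
(* Chosen so that the error term is at most [c]; [k.+1] in place of [k] keeps [delta] positive for
   empty [K]. *)
pose delta := Num.sqrt (c / (ln 2 * k.+1%:R)).
have d2 : ln 2 * (k%:R * delta ^+ 2) <= c.
  have k0 : 0 < k.+1%:R :> R by rewrite ltr0n.
  rewrite sqr_sqrtr; last by rewrite ltW // divr_gt0 // mulr_gt0.
  have -> : ln 2 * (k%:R * (c / (ln 2 * k.+1%:R))) = c * (k%:R / k.+1%:R).
    by move: k0 ln2; move: (ln 2) k.+1%:R => l k' ? ?; field; rewrite !gt_eqF.
  by rewrite ger_pMr // ler_pdivrMr // mul1r ler_nat.
apply: (@le_lt_trans _ _ (ln #|A|%:R - c)%:E); last first.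
  by rewrite /= leNgt a0 /= lte_fin ltrBlDr ltrDl.
apply: sofic_entropy_le => eps e0; exists K, delta; split.
  by rewrite sqrtr_gt0 divr_gt0 // mulr_gt0 // ltr0n.
exists i0 => i /hi0 hG.
have [n [hN hn]] := N_sep_forbidden_le delta Hmon e0 A0 forb (hDelta i) hG.
have d0 : 0 < #|D i|%:R :> R by rewrite ltr0n.
apply: (@le_trans _ _ ((#|D i|%:R^-1)%:E * elog n%:R%:E)%E).
  by apply: lee_wpmul2l; [rewrite lee_fin invr_ge0|exact: elog_le].
rewrite /=; case: ifPn => [_|]; first by rewrite gt0_muleNy ?leNye // lte_fin invr_gt0.
rewrite -ltNge => n0; rewrite -EFinM lee_fin ler_pdivrMl //.
have aD : 0 < #|A|%:R ^+ #|D i| :> R by rewrite exprn_gt0.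
rewrite -ler_ln ?posrE ?mulr_gt0 ?expR_gt0 // in hn.
apply: le_trans hn _; rewrite !lnM ?posrE ?mulr_gt0 ?expR_gt0 // !expRK lnXn //.
rewrite -[ln _ *+ _]mulr_natl -/k -/b -/q.
rewrite [X in X <= _](_ : _ = #|D i|%:R * (ln 2 * (k%:R * delta ^+ 2) + ln #|A|%:R - 2 * c)); last first.
  by rewrite /c; field; rewrite gt_eqF.
by rewrite ler_pM2l //; lra.
Qed.

End Net.
End Entropy.

Theorem theorem5p3 (R : realType) (M : Type) (mul : M -> M -> M) (one : M)
  (HM : is_monoid mul one) (Minf : infinite_set [set: M])
  (Hsofic : strongly_sofic mul one)
  (I : Type) (le : I -> I -> Prop) (D : I -> finType) (sigma : forall i, M -> D i -> D i)
  (HSigma : strong_sofic_approx R mul one le sigma)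
  (A : finType) (X : set (M -> A)) (HX : subshift mul X) :
  (sofic_entropy R mul one le sigma X <= elog (#|A|%:R : R)%:E)%E /\
  (sofic_entropy R mul one le sigma X = elog (#|A|%:R : R)%:E <-> X = [set: M -> A]).
Proof.
split; first exact: sofic_entropy_le_elog_card.
split=> [e|->].
  apply: contrapT => Xn; have := sofic_entropy_lt HSigma HM HX.1 Xn.
  by rewrite e ltxx.
apply/le_anti/andP; split; first exact: sofic_entropy_le_elog_card.
exact: sofic_entropy_fullshift.
Qed.
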